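(* Let $Y\sim\mathrm{SUN}_{d,m}(\xi,\Omega,\Delta,\tau,\Gamma)$ be partitioned as $$Y=\begin{pmatrix}Y_1\\ Y_2\end{pmatrix},\ \xi=\begin{pmatrix}\xi_1\\ \xi_2\end{pmatrix},\ \Omega=\begin{pmatrix}\Omega_{11}&\Omega_{12}\\ \Omega_{21}&\Omega_{22}\end{pmatrix},\ \bar\Omega=\begin{pmatrix}\bar\Omega_{11}&\bar\Omega_{12}\\ \bar\Omega_{21}&\bar\Omega_{22}\end{pmatrix},\ \omega=\begin{pmatrix}\omega_1&0\\ 0&\omega_2\end{pmatrix},\ \Delta=\begin{pmatrix}\Delta_1\\ \Delta_2\end{pmatrix},$$ where $Y_1$ and $Y_2$ have dimensions $d_1$ and $d_2$, $d_1+d_2=d$, and let $y_1\in\mathbb{R}^{d_1}$. Then $$(Y_2\mid Y_1+y_1>0)\sim\mathrm{SUN}_{d_2,d_1+m}\left(\xi_2,\ \Omega_{22},\ (\bar\Omega_{21},\Delta_2),\ \begin{pmatrix}\tilde z_1\\ \tau\end{pmatrix},\ \begin{pmatrix}\bar\Omega_{11}&\Delta_1\\ \Delta_1^{\top}&\Gamma\end{pmatrix}\right),$$ where $\tilde z_1=\omega_1^{-1}(\xi_1+y_1)$ and the inequality is intended to hold for each component of $Y_1$, if $d_1>1$. In the case where the inequality sign is reversed, $$(Y_2\mid Y_1+y_1<0)\sim\mathrm{SUN}_{d_2,d_1+m}\left(\xi_2,\ \Omega_{22},\ (-\bar\Omega_{21},\Delta_2),\ \begin{pmatrix}\hat z_1\\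 \tau\end{pmatrix},\ \begin{pmatrix}\bar\Omega_{11}&-\Delta_1\\ -\Delta_1^{\top}&\Gamma\end{pmatrix}\right),$$ where $\hat z_1=\omega_1^{-1}(\xi_1-y_1)$.
   Context: Let $d,m$ be positive integers. Let $\Omega^*=\begin{pmatrix}\bar\Omega&\Delta\\ \Delta^{\top}&\Gamma\end{pmatrix}$ be a full-rank $(d+m)\times(d+m)$ correlation matrix ($\bar\Omega$ is $d\times d$, $\Delta$ is $d\times m$, $\Gamma$ is $m\times m$), let $\tau\in\mathbb{R}^m$, $\xi\in\mathbb{R}^d$, let $\omega$ be a $d\times d$ diagonal matrix with positive diagonal elements, and $\Omega=\omega\bar\Omega\omega$. If $(X_0,X_1)\sim \mathrm{N}_{d+m}(0,\Omega^* )$, with $X_0$ of dimension $d$, $\mathrm{SUN}_{d,m}(\xi,\Omega,\Delta,\tau,\Gamma)$ denotes the distribution of $\xi+\omega Z$, where $Z$ has the distribution of $X_0$ conditional on $X_1+\tau>0$ (componentwise). The matrices $\omega$ and $\bar\Omega$ are determined by $\Omega$ (the square roots of its diagonal elements, and the associated correlation matrix). Here $(M,N)$ denotes the matrix with blocks $M$ and $N$ placed side by side, and $(Y_2\mid E)$ denotes $Y_2$ conditional on the event $E$.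
   Formalization: In the reversed-inequality claim, ẑ₁ is taken as ω₁⁻¹(−ξ₁ − y₁) instead of the printed ω₁⁻¹(ξ₁ − y₁), which makes the claim false in general when ξ₁ ≠ 0 (e.g. d₁=d₂=m=1, Δ=0, Γ=1, ρ>0, ξ=(1,0), τ=y₁=0). *)

(* Defs.v *)
From HB Require Import structures.
From mathcomp Require Import all_boot all_order all_algebra.
From mathcomp Require Import all_classical all_reals all_analysis.

Set Implicit Arguments.
Unset Strict Implicit.
Unset Printing Implicit Defensive.

Import Order.TTheory GRing.Theory Num.Theory.
Import numFieldNormedType.Exports.

Local Open Scope classical_set_scope.
Local Open Scope ring_scope.

(* Column vectors carry the product sigma-algebra, i.e. the one generated by
   the coordinates; for T = R this is the Borel sigma-algebra of R^n. *)
Section measurable_colvec.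
Context {d : measure_display} {T : measurableType d}.
Variable n : nat.

Let coors : 'I_n -> 'cV[T]_n -> T := fun i v => v i 0.

Let cV_set0 : g_sigma_preimage coors set0.
Proof. exact: sigma_algebra0. Qed.

Let cV_setC A : g_sigma_preimage coors A -> g_sigma_preimage coors (~` A).
Proof. exact: sigma_algebraC. Qed.

Let cV_bigcup (F : (set 'cV[T]_n)^nat) :
  (forall i, g_sigma_preimage coors (F i)) ->
  g_sigma_preimage coors (\bigcup_i (F i)).
Proof. exact: sigma_algebra_bigcup. Qed.

HB.instance Definition _ := @isMeasurable.Build (measure_tuple_display d)
  'cV[T]_n (g_sigma_preimage coors) cV_set0 cV_setC cV_bigcup.

End measurable_colvec.

Section correlation.
Context {R : realType}.

Definition correlation_mx n (S : 'M[R]_n) : Prop :=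
  [/\ S^T = S,
      (forall i, S i i = 1) &
      (forall v : 'cV[R]_n, 0 <= (v^T *m S *m v) 0 0)].

Definition full_rank n (S : 'M[R]_n) : Prop := \rank S = n.

(* The diagonal matrix omega and the correlation matrix Obar determined by
   a covariance matrix Omega = omega * Obar * omega. *)
Definition scale_mx n (Omega : 'M[R]_n) : 'M[R]_n :=
  diag_mx (\row_i Num.sqrt (Omega i i)).

Definition corr_mx n (Omega : 'M[R]_n) : 'M[R]_n :=
  invmx (scale_mx Omega) *m Omega *m invmx (scale_mx Omega).

End correlation.

Section probability.
Context {R : realType} {d : measure_display} {T : measurableType d}.
Variable P : probability T R.

(* Independence of the whole finite family; taking B i = setT for some of the
   indices gives the product rule for every subfamily. *)
Definition mutually_independent k (G : 'I_k -> {RV P >-> R}) : Prop :=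
  forall B : 'I_k -> set R, (forall i, measurable (B i)) ->
    P (\bigcap_i (G i @^-1` B i)) = (\prod_(i < k) P (G i @^-1` B i))%E.

Definition standard_normal_family k (G : 'I_k -> {RV P >-> R}) : Prop :=
  mutually_independent G /\
  forall i (B : set R), measurable B -> P (G i @^-1` B) = normal_prob 0 1 B.

(* X ~ N_n(mu, Sigma): X is an affine image mu + A G of a vector G of
   independent standard normal variables, with A A^T = Sigma. When Sigma is
   invertible, such a G always exists on the sample space of X itself, e.g.
   G = Sigma^(-1/2) (X - mu). *)
Definition normal_vector n (X : {RV P >-> 'cV[R]_n})
    (mu : 'cV[R]_n) (Sigma : 'M[R]_n) : Prop :=
  exists k (A : 'M[R]_(n, k)) (G : 'I_k -> {RV P >-> R}),
    [/\ standard_normal_family G,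
        A *m A^T = Sigma &
        forall t, X t = mu + A *m \col_i G i t].

(* The distribution of X conditional on the event E, as a function of the
   Borel set B; meaningful when P E > 0. *)
Definition cond_distribution d' (T' : measurableType d') (X : T -> T')
    (E : set T) : set T' -> \bar R :=
  fun B => (fine (P (X @^-1` B `&` E)) / fine (P E))%:E.

End probability.

(* nu = SUN_{d,m}(xi, Omega, Delta, tau, Gamma). The conditioning event
   X_1 + tau > 0 has positive probability, since Omega^* is full-rank. *)
Definition is_SUN {R : realType} d m (nu : set 'cV[R]_d -> \bar R)
    (xi : 'cV[R]_d) (Omega : 'M[R]_d) (Delta : 'M[R]_(d, m))
    (tau : 'cV[R]_m) (Gamma : 'M[R]_m) : Prop :=
  let Omega_star := block_mx (corr_mx Omega) Delta Delta^T Gamma in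
  [/\ (forall i, 0 < Omega i i),
      correlation_mx Omega_star,
      full_rank Omega_star &
      exists (disp : measure_display) (S : measurableType disp)
             (Q : probability S R) (X : {RV Q >-> 'cV[R]_(d + m)}),
        normal_vector X 0 Omega_star /\
        forall B : set 'cV[R]_d, measurable B ->
          nu B = cond_distribution Q
            (fun s => xi + scale_mx Omega *m usubmx (X s))
            [set s | forall i, 0 < (dsubmx (X s) + tau) i 0] B].

(* Main.v *)
Require Import Defs.
From HB Require Import structures.
From mathcomp Require Import all_boot all_order all_algebra.
From mathcomp Require Import all_classical all_reals all_analysis.
From mathcomp Require Import measurable_realfun ring lra.

(** Write Y = xi + omega U, where (U, V) is the normal vector with correlation
matrix Omega_star, conditioned on V + tau > 0. Conditioning Y further on the
signs of Y_1 + y_1 is again conditioning (U, V) on an orthant event: omega_1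
is diagonal with a positive diagonal, so that for s = 1 or s = -1

  s (Y_1 + y_1) > 0  <->  s U_1 + omega_1^-1 s (xi_1 + y_1) > 0.

Hence the conditional law of Y_2 is read off the vector (U_2, (s U_1, V)),
whose last d1 + m coordinates carry all the sign conditions. This vector is
the image of (U, V) under a signed permutation matrix M (flip_perm_mx). It is
normal with correlation matrix M Omega_star M^T, whose blocks are those of the
new SUN parameters; as M is orthogonal, the latter matrix is still a
correlation matrix of full rank. Both claims of the theorem are the cases
s = 1 and s = -1 of SUN_cond_orthant.

Two successive conditionings amount to one conditioning on the intersection
only because the probabilities involved do not vanish. This is
normal_orthant_gt0: a vector mu + A G with A A^T invertible ranges over the
whole space, so that some value of G puts it inside the orthant, and so does a
whole box around this value; the box has positive probability since the
coordinates of G are independent and the normal density is positive. *)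

Set Implicit Arguments.
Unset Strict Implicit.
Unset Printing Implicit Defensive.

Import Order.TTheory GRing.Theory Num.Theory.
Import numFieldNormedType.Exports.

Local Open Scope classical_set_scope.
Local Open Scope ring_scope.

(** * Measurability on spaces of column vectors *)

Section measurable_colvec.
Context {d : measure_display} {T : measurableType d}.

Lemma measurable_coord n (i : 'I_n) :
  measurable_fun [set: 'cV[T]_n] (fun v => v i 0).
Proof.
move=> _ Y mY; rewrite setTI; apply: sub_sigma_algebra => /=.
rewrite -bigcup_seq/=; exists i => /=; first by rewrite mem_index_enum.
by exists Y => //; rewrite setTI.
Qed.

Lemma measurable_fun_colvec d' (S : measurableType d') n (f : S -> 'cV[T]_n) :
  (forall i, measurable_fun setT (fun x => f x i 0)) -> measurable_fun setT f.
Proof.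
move=> mf; apply: (@measurability _ _ _ _ setT f
  (\big[setU/set0]_(i < n)
    preimage_set_system setT (fun v : 'cV[T]_n => v i 0) measurable)) => //.
move=> _ [B + <-]; rewrite -bigcup_seq => -[i _ [C mC <-]].
by rewrite setTI; have := mf i measurableT C mC; rewrite !setTI.
Qed.

End measurable_colvec.

Section measurable_colvec_real.
Context {R : realType}.

Lemma measurable_mulmx n p (M : 'M[R]_(p, n)) :
  measurable_fun [set: 'cV[R]_n] (mulmx M).
Proof.
apply: measurable_fun_colvec => i; under eq_fun do rewrite mxE.
apply: measurable_sum => j.
by apply: measurable_funM => //; exact: measurable_coord.
Qed.

Lemma measurable_orthant n : measurable [set v : 'cV[R]_n | forall i, 0 < v i 0].
Proof.
rewrite [X in measurable X](_ : _ =
    \bigcap_(i in [set: 'I_n]) (fun v : 'cV[R]_n => v i 0) @^-1` `]0, +oo[).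
  by apply: fin_bigcap_measurable => // i _; rewrite -[X in measurable X]setTI;
    exact: measurable_coord.
apply/seteqP; split=> v /= v0 i.
  by move=> _; rewrite /= in_itv/= v0.
by have := v0 i I; rewrite /= in_itv/= andbT.
Qed.

Lemma measurable_shifted_orthant n (c : 'cV[R]_n) :
  measurable [set v : 'cV[R]_n | forall i, 0 < (v + c) i 0].
Proof.
have mf : measurable_fun setT (fun v : 'cV[R]_n => v + c).
  apply: measurable_fun_colvec => i; under eq_fun do rewrite mxE.
  by apply: measurable_funD => //; exact: measurable_coord.
by have := mf measurableT _ (@measurable_orthant n); rewrite setTI.
Qed.

Lemma measurable_dsubmx n1 n2 : measurable_fun setT (@dsubmx R n1 n2 1).
Proof.
apply: measurable_fun_colvec => i; under eq_fun do rewrite mxE.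
exact: measurable_coord.
Qed.

Lemma measurable_dsubmx_orthant n1 n2 (c : 'cV[R]_n2) :
  measurable [set v : 'cV[R]_(n1 + n2) | forall i, 0 < (dsubmx v + c) i 0].
Proof.
have := @measurable_dsubmx n1 n2 measurableT _ (measurable_shifted_orthant c).
by rewrite setTI.
Qed.

Lemma measurable_usubmx_orthant n1 n2 (s : R) (y : 'cV[R]_n1) :
  measurable
    [set v : 'cV[R]_(n1 + n2) | forall i, 0 < (s *: (usubmx v + y)) i 0].
Proof.
have mf : measurable_fun setT
    (fun v : 'cV[R]_(n1 + n2) => s *: (usubmx v + y)).
  apply: measurable_fun_colvec => i; under eq_fun do rewrite !mxE.
  by apply: measurable_funM => //; apply: measurable_funD => //;
    exact: measurable_coord.
by have := mf measurableT _ (@measurable_orthant n1); rewrite setTI.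
Qed.

End measurable_colvec_real.

(** * Positivity of normal probabilities *)

(** The density does not vanish, so an interval of probability zero would be
Lebesgue-negligible. *)
Lemma normal_prob_itv_gt0 (R : realType) (m s a b : R) : s != 0 -> a < b ->
  (0 < normal_prob m s `]a, b[%classic)%E.
Proof.
move=> s0 ab; rewrite lt_neqAle measure_ge0 andbT eq_sym; apply/eqP => itv0.
have mitv : measurable (`]a, b[%classic : set R) by [].
have mf : measurable_fun `]a, b[%classic (EFin \o normal_pdf m s).
  by apply/measurable_EFinP; apply: measurable_funTS; exact: measurable_normal_pdf.
have : (\int[lebesgue_measure]_(x in `]a, b[) `|(normal_pdf m s x)%:E| = 0)%E.
  rewrite -[RHS]itv0; apply: eq_integral => x _.
  by rewrite gee0_abs// lee_fin normal_pdf_ge0.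
move/(ae_eq_integral_abs lebesgue_measure mitv mf) => [N [mN N0 subN]].
have : lebesgue_measure (`]a, b[%classic : set R) = 0%E.
  apply: (@subset_measure0 _ _ _ lebesgue_measure _ N _ mN _ N0) => [|x xab].
    exact: mitv.
  apply: subN => /= /(_ xab) /eqP.
  rewrite eqe gt_eqF// normal_pdfE//.
  by rewrite mulr_gt0 ?normal_peak_gt0// expR_gt0.
rewrite lebesgue_measure_itv/= lte_fin ab -EFinD => /eqP.
by rewrite eqe subr_eq0 gt_eqF.
Qed.

Section normal_vector.
Context {R : realType} {d : measure_display} {T : measurableType d}.
Variable P : probability T R.

Definition mulmx_RV n p (M : 'M[R]_(p, n)) (X : {RV P >-> 'cV[R]_n}) :
  T -> 'cV[R]_p := fun t => M *m X t.

Lemma measurable_mulmx_RV n p (M : 'M[R]_(p, n)) (X : {RV P >-> 'cV[R]_n}) :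
  measurable_fun setT (mulmx_RV M X).
Proof. by apply: (measurableT_comp (measurable_mulmx M)). Qed.

HB.instance Definition _ n p (M : 'M[R]_(p, n)) (X : {RV P >-> 'cV[R]_n}) :=
  @isMeasurableFun.Build _ _ _ _ (mulmx_RV M X) (measurable_mulmx_RV M X).

Lemma normal_vector_mul n p (M : 'M[R]_(p, n)) (X : {RV P >-> 'cV[R]_n}) mu S :
  normal_vector X mu S ->
  normal_vector (mulmx_RV M X : {RV P >-> 'cV[R]_p}) (M *m mu) (M *m S *m M^T).
Proof.
move=> [k [A [G [stdG <- XE]]]]; exists k, (M *m A), G; split => //.
  by rewrite trmx_mul !mulmxA.
by move=> t; rewrite /= /mulmx_RV XE mulmxDr mulmxA.
Qed.

Lemma standard_normal_box_gt0 k (G : 'I_k -> {RV P >-> R}) (g : 'cV[R]_k)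
    (e : R) : standard_normal_family G -> 0 < e ->
  (0 < P (\bigcap_i (G i @^-1` `](g i 0 - e)%R, (g i 0 + e)%R[)))%E.
Proof.
move=> [indG stdG] e0; rewrite indG//.
apply: (big_ind (fun x => 0 < x)%E) => //.
  by move=> x y; exact: mule_gt0.
move=> i _; rewrite stdG// normal_prob_itv_gt0//.
by rewrite ltrD2l gtrN.
Qed.

(** Since A A^T = S is invertible, A has a right inverse, so mu + A g + c takes
the value (1, ..., 1) at some g. By continuity all its coordinates stay
positive on a box around g, and G falls in that box with positive
probability. *)
Lemma normal_orthant_gt0 n (X : {RV P >-> 'cV[R]_n}) mu S (c : 'cV[R]_n) :
  normal_vector X mu S -> full_rank S ->
  (0 < P [set t | forall i, (0 < (X t + c) i 0)%R])%E.
Proof.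
move=> [k [A [G [stdG AS XE]]]] rS.
have SU : S \in unitmx by rewrite -row_full_unit /row_full rS.
pose g := A^T *m invmx S *m (const_mx 1 - mu - c).
have Ag : A *m g = const_mx 1 - mu - c.
  by rewrite /g !mulmxA AS mulmxV// mul1mx.
pose N := \sum_i \sum_j `|A i j|.
have N0 : 0 <= N by do 2!apply: sumr_ge0 => ? _.
(* The half-width e of the box is chosen so that A moves no coordinate by as
   much as 1, because N * e < 1. *)
pose e := (1 + N)^-1.
have e0 : 0 < e by rewrite invr_gt0 ltr_pwDl.
apply: (lt_le_trans (standard_normal_box_gt0 g stdG e0)).
apply: le_measure; rewrite ?inE.
- by apply: fin_bigcap_measurable => // i _; exact: measurable_funPTI.
- exact: (measurable_funPTI X (measurable_shifted_orthant c)).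
move=> t /= Gt i.
pose h : 'cV[R]_k := \col_j G j t.
have -> : (X t + c) i 0 = 1 + (A *m (h - g)) i 0.
  have -> : X t + c = const_mx 1 + A *m (h - g).
    rewrite XE mulmxBr Ag -/h !opprB.
    by apply/matrixP=> i' j'; rewrite !mxE; ring.
  by rewrite !mxE.
have hg j : `|(h - g) j 0| <= e.
  have := Gt j I; rewrite /= in_itv/= !mxE => /andP[? ?].
  by rewrite ler_norml; apply/andP; split; lra.
have Ahg : `|(A *m (h - g)) i 0| <= N * e.
  rewrite mxE (le_trans (ler_norm_sum _ _ _))// /N (bigD1 i)//= mulrDl.
  rewrite ler_wpDr//.
    by apply: mulr_ge0; [do 2!apply: sumr_ge0 => ? _ | exact: ltW].
  rewrite mulr_suml; apply: ler_sum => j _.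
  by rewrite normrM ler_wpM2l.
have Ne : N * e < 1 by rewrite /e ltr_pdivrMr ?mul1r ?ltr_pwDl//; lra.
by move: Ahg; rewrite ler_norml => /andP[? _]; lra.
Qed.

End normal_vector.

(** * The signed permutation of the coordinates *)

Section reordering.
Context {R : realType}.
Variables d1 d2 m : nat.

(** The matrix of the map (u, v, w) |-> (v, s u, w), which moves the
conditioned coordinates u next to the coordinates w of the latent vector. *)
Definition flip_perm_mx (s : R) : 'M[R]_(d2 + (d1 + m), d1 + d2 + m) :=
  block_mx (row_mx 0 1%:M) 0 (col_mx (row_mx s%:M 0) 0) (col_mx 0 1%:M).

Lemma mul_flip_perm_mx s k (u : 'M[R]_(d1, k)) (v : 'M[R]_(d2, k))
    (w : 'M[R]_(m, k)) :
  flip_perm_mx s *m col_mx (col_mx u v) w = col_mx v (col_mx (s *: u) w).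
Proof.
rewrite mul_block_col mul_row_col !mul_col_mx mul_row_col add_col_mx.
by rewrite !mul0mx !mul1mx mul_scalar_mx !addr0 !add0r.
Qed.

Let mul_blocks := (mulmx_block, mul_row_block, mul_row_col, mul_col_mx,
  mul_mx_row, mul_col_row).
Let simp_blocks := (mul0mx, mulmx0, mul1mx, mulmx1, mul_scalar_mx,
  mul_mx_scalar, add_row_mx, add_col_mx, row_mx0, col_mx0, addr0, add0r).

Lemma flip_perm_mxK s : s * s = 1 ->
  flip_perm_mx s *m (flip_perm_mx s)^T = 1%:M.
Proof.
move=> ss; rewrite /flip_perm_mx tr_block_mx !tr_row_mx !tr_col_mx !tr_row_mx.
rewrite !trmx0 !trmx1 tr_scalar_mx.
rewrite !(mul_blocks, simp_blocks) scale_scalar_mx ss.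
by rewrite -block_mxEv -!scalar_mx_block.
Qed.

(** The matrix is not square up to conversion: the dimensions d2 + (d1 + m) and
(d1 + d2) + m are only provably equal. Computing the other product avoids a
cast. *)
Lemma flip_perm_mxKV s : s * s = 1 ->
  (flip_perm_mx s)^T *m flip_perm_mx s = 1%:M.
Proof.
move=> ss; rewrite /flip_perm_mx tr_block_mx !tr_row_mx !tr_col_mx !tr_row_mx.
rewrite !trmx0 !trmx1 tr_scalar_mx.
rewrite !(mul_blocks, simp_blocks) scale_scalar_mx ss.
by rewrite -block_mxEv -!scalar_mx_block.
Qed.

Lemma flip_perm_mx_conj s (a : 'M[R]_d1) (b : 'M[R]_(d2, d1)) (c : 'M[R]_d2)
    (p : 'M[R]_(d1, m)) (q : 'M[R]_(d2, m)) (g : 'M[R]_m) : s * s = 1 ->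
  flip_perm_mx s *m
    block_mx (block_mx a b^T b c) (col_mx p q) (col_mx p q)^T g *m
    (flip_perm_mx s)^T =
  block_mx c (row_mx (s *: b) q) (row_mx (s *: b) q)^T
    (block_mx a (s *: p) (s *: p)^T g).
Proof.
move=> ss; rewrite /flip_perm_mx !tr_block_mx !tr_row_mx !tr_col_mx !tr_row_mx.
rewrite !trmx0 !trmx1 tr_scalar_mx !(mul_blocks, simp_blocks).
rewrite !linearZ/= scalerA ss scale1r.
by rewrite -block_mxEv [X in X + _]block_mxEh !simp_blocks -block_mxEh.
Qed.

End reordering.

(** * Correlation matrices under reordering and restriction *)

Section correlation.
Context {R : realType}.

Lemma drsubmxE p1 p2 q1 q2 (A : 'M[R]_(p1 + p2, q1 + q2)) i j :
  drsubmx A i j = A (rshift p1 i) (rshift q1 j).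
Proof. by rewrite !mxE. Qed.

Lemma full_rank_conj n p (M : 'M[R]_(p, n)) (S : 'M[R]_n) :
  M *m M^T = 1%:M -> M^T *m M = 1%:M -> full_rank S ->
  full_rank (M *m S *m M^T).
Proof.
move=> MMt MtM rS; have rM : \rank M = p.
  by apply/eqP; apply/row_freeP; exists M^T.
have fM : row_free M^T by apply/row_freeP; exists M.
have fS : row_free S by apply/eqP.
by rewrite /full_rank mxrankMfree// mxrankMfree.
Qed.

Lemma correlation_mx_conj n p (M : 'M[R]_(p, n)) (S : 'M[R]_n) :
  correlation_mx S -> (forall i, (M *m S *m M^T) i i = 1) ->
  correlation_mx (M *m S *m M^T).
Proof.
move=> [symS _ psdS] diag1; split => //.
  by rewrite !trmx_mul trmxK symS mulmxA.
move=> v; rewrite -[v^T *m _ *m _](_ : (M^T *m v)^T *m S *m (M^T *m v) = _)//.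
by rewrite trmx_mul trmxK !mulmxA.
Qed.

Lemma invmx_diag n (u : 'rV[R]_n) : (forall i, u 0 i != 0) ->
  invmx (diag_mx u) = diag_mx (map_mx GRing.inv u).
Proof.
move=> u0; have uV : diag_mx u *m diag_mx (map_mx GRing.inv u) = 1%:M.
  apply/matrixP=> i j; rewrite mul_diag_mx !mxE.
  by case: eqVneq => _; rewrite ?mulr1n ?divff ?mulr0n ?mulr0.
have [uU _] := mulmx1_unit uV.
by rewrite -[LHS]mulmx1 -uV mulKmx.
Qed.

Lemma scale_mx_inv n (Omega : 'M[R]_n) : (forall i, 0 < Omega i i) ->
  invmx (scale_mx Omega) = diag_mx (\row_i (Num.sqrt (Omega i i))^-1).
Proof.
move=> O0; rewrite /scale_mx invmx_diag => [|i]; last first.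
  by rewrite mxE gt_eqF// sqrtr_gt0.
by congr diag_mx; apply/rowP => i; rewrite !mxE.
Qed.

Lemma corr_mxE n (Omega : 'M[R]_n) i j : (forall i, 0 < Omega i i) ->
  corr_mx Omega i j =
    (Num.sqrt (Omega i i))^-1 * Omega i j * (Num.sqrt (Omega j j))^-1.
Proof.
by move=> O0; rewrite /corr_mx scale_mx_inv// mul_mx_diag mxE mul_diag_mx !mxE.
Qed.

Lemma corr_mx_drsub n1 n2 (Omega : 'M[R]_(n1 + n2)) : (forall i, 0 < Omega i i) ->
  corr_mx (drsubmx Omega) = drsubmx (corr_mx Omega).
Proof.
move=> O0; apply/matrixP=> i j; rewrite corr_mxE => [|k]; last by rewrite !mxE.
by rewrite !drsubmxE corr_mxE.
Qed.

End correlation.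

(** * Conditioning on the signs of some coordinates *)

Section orthant_conditioning.
Context {R : realType} {d1 d2 m : nat}.

Variables (s : R) (xi : 'cV[R]_(d1 + d2)) (Omega : 'M[R]_(d1 + d2)).
Variables (Delta : 'M[R]_(d1 + d2, m)) (Gamma : 'M[R]_m).
Variables (y1 : 'cV[R]_d1).
Hypotheses (ss : s * s = 1) (O0 : forall i, 0 < Omega i i).

Let Obar := corr_mx Omega.
Let om := scale_mx Omega.
Let Delta1 := usubmx Delta.
Let Delta2 := dsubmx Delta.
Let z1 := invmx (ulsubmx om) *m (s *: (usubmx xi + y1)).

Lemma scale_mx_block :
  om = block_mx (ulsubmx om) 0 0 (scale_mx (drsubmx Omega)).
Proof.
rewrite -[LHS]submxK; congr block_mx; apply/matrixP => i j; rewrite !mxE.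
- by rewrite eq_lrshift.
- by rewrite eq_rlshift.
- by rewrite eq_rshift.
Qed.

Lemma scale_mx_ulsub : ulsubmx om = scale_mx (ulsubmx Omega).
Proof. by apply/matrixP => i j; rewrite !mxE eq_lshift. Qed.

Lemma usubmx_affine (u : 'cV[R]_d1) (v : 'cV[R]_d2) :
  usubmx (xi + om *m col_mx u v) = usubmx xi + scale_mx (ulsubmx Omega) *m u.
Proof.
rewrite scale_mx_block mul_block_col !mul0mx addr0 linearD/= col_mxKu.
by rewrite scale_mx_ulsub.
Qed.

Lemma dsubmx_affine (u : 'cV[R]_d1) (v : 'cV[R]_d2) :
  dsubmx (xi + om *m col_mx u v) = dsubmx xi + scale_mx (drsubmx Omega) *m v.
Proof.
by rewrite scale_mx_block mul_block_col !mul0mx add0r linearD/= col_mxKd.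
Qed.

(** The scaling of the first block multiplies each coordinate by a positive
number, so it does not change signs. *)
Lemma orthant_standardized (u : 'cV[R]_d1) (v : 'cV[R]_d2) :
  (forall i, 0 < (s *: u + z1) i 0) <->
  (forall i, 0 < (s *: (usubmx (xi + om *m col_mx u v) + y1)) i 0).
Proof.
have O10 i : 0 < ulsubmx Omega i i by rewrite !mxE.
have sO i : 0 < Num.sqrt (ulsubmx Omega i i) by rewrite sqrtr_gt0.
have -> : s *: (usubmx (xi + om *m col_mx u v) + y1) =
    scale_mx (ulsubmx Omega) *m (s *: u + z1).
  rewrite /z1 scale_mx_ulsub mulmxDr mulKVmx; last first.
    rewrite unitmxE det_diag unitfE prodf_seq_neq0; apply/allP => i _ /=.
    by rewrite mxE gt_eqF.
  rewrite usubmx_affine -scalemxAr -scalerDr.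
  by congr (_ *: _); rewrite addrAC addrC.
have scaleE (w : 'cV[R]_d1) i :
    (scale_mx (ulsubmx Omega) *m w) i 0 = Num.sqrt (ulsubmx Omega i i) * w i 0.
  by rewrite mul_diag_mx !mxE.
by split=> H i; move: (H i); rewrite scaleE pmulr_rgt0.
Qed.

Let Omega_star := block_mx Obar Delta Delta^T Gamma.
Let Omega_star' := block_mx (corr_mx (drsubmx Omega))
  (row_mx (s *: dlsubmx Obar) Delta2) (row_mx (s *: dlsubmx Obar) Delta2)^T
  (block_mx (ulsubmx Obar) (s *: Delta1) (s *: Delta1)^T Gamma).

Lemma flip_perm_mx_Omega_star : Omega_star^T = Omega_star ->
  flip_perm_mx d1 d2 m s *m Omega_star *m (flip_perm_mx d1 d2 m s)^T =
  Omega_star'.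
Proof.
rewrite /Omega_star tr_block_mx => /eq_block_mx[symO _ _ _].
have symO12 : ursubmx Obar = (dlsubmx Obar)^T.
  by rewrite -[in RHS]symO -trmx_ursub trmxK.
rewrite -{1}[Obar]submxK symO12 -[Delta]vsubmxK flip_perm_mx_conj//.
by rewrite /Omega_star' corr_mx_drsub.
Qed.

Lemma correlation_mx_star' :
  correlation_mx Omega_star -> correlation_mx Omega_star'.
Proof.
move=> corrS; have [symS diagS _] := corrS.
rewrite -flip_perm_mx_Omega_star//; apply: correlation_mx_conj => // i.
rewrite flip_perm_mx_Omega_star// /Omega_star' corr_mx_drsub//.
have dO j : Obar j j = 1 by have := diagS (lshift m j); rewrite block_mxEul.
have dG j : Gamma j j = 1 by have := diagS (rshift _ j); rewrite block_mxEdr.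
case: (split_ordP i) => [j ->|k ->]; rewrite ?block_mxEul ?block_mxEdr.
  by rewrite drsubmxE dO.
case: (split_ordP k) => [j ->|j ->]; rewrite ?block_mxEul ?block_mxEdr//.
by rewrite 2!mxE dO.
Qed.

End orthant_conditioning.

(** Both directions of the inequality at once: s = 1 keeps the sign of
Y_1 + y_1 and s = -1 reverses it. The new SUN law is realised on the sample
space of the normal vector behind Y, by reordering that vector. *)
Lemma SUN_cond_orthant (R : realType) (d1 d2 m : nat) (s : R)
    (xi : 'cV[R]_(d1 + d2)) (Omega : 'M[R]_(d1 + d2))
    (Delta : 'M[R]_(d1 + d2, m)) (tau : 'cV[R]_m) (Gamma : 'M[R]_m)
    (disp : measure_display) (T : measurableType disp) (P : probability T R)
    (Y : {RV P >-> 'cV[R]_(d1 + d2)}) (y1 : 'cV[R]_d1) :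
  s * s = 1 ->
  is_SUN (distribution P Y) xi Omega Delta tau Gamma ->
  let E := [set t | forall i, 0 < (s *: (usubmx (Y t) + y1)) i 0] in
  let Obar21 := dlsubmx (corr_mx Omega) in
  (0 < P E)%E /\
  is_SUN (cond_distribution P (fun t => dsubmx (Y t)) E)
    (dsubmx xi) (drsubmx Omega) (row_mx (s *: Obar21) (dsubmx Delta))
    (col_mx (invmx (ulsubmx (scale_mx Omega)) *m (s *: (usubmx xi + y1))) tau)
    (block_mx (ulsubmx (corr_mx Omega)) (s *: usubmx Delta)
       (s *: usubmx Delta)^T Gamma).
Proof.
move=> ss [ O0 corrS rS [d' [S [Q [X [NX YE]]]]]] E Obar21.
set z1 := invmx _ *m (s *: _).
have [symS _ _] := corrS.
pose X' : {RV Q >-> 'cV[R]_(d2 + (d1 + m))} :=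
  mulmx_RV (flip_perm_mx d1 d2 m s) X.
have NX' := normal_vector_mul (flip_perm_mx d1 d2 m s) NX.
rewrite mulmx0 flip_perm_mx_Omega_star// in NX'.
have rS' : full_rank (block_mx (corr_mx (drsubmx Omega))
  (row_mx (s *: Obar21) (dsubmx Delta)) (row_mx (s *: Obar21) (dsubmx Delta))^T
  (block_mx (ulsubmx (corr_mx Omega)) (s *: usubmx Delta)
     (s *: usubmx Delta)^T Gamma)).
  rewrite -flip_perm_mx_Omega_star//; apply: full_rank_conj => //.
    exact: flip_perm_mxK.
  exact: flip_perm_mxKV.
pose C := [set w | forall i, 0 < (dsubmx (X w) + tau) i 0].
pose F := [set w | forall i, 0 < (dsubmx (X' w) + col_mx z1 tau) i 0].
pose Z w := xi + scale_mx Omega *m usubmx (X w).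
have X'E w : X' w = col_mx (dsubmx (usubmx (X w)))
    (col_mx (s *: usubmx (usubmx (X w))) (dsubmx (X w))).
  by rewrite /= /mulmx_RV -{1}[X w]vsubmxK -{1}[usubmx (X w)]vsubmxK
    mul_flip_perm_mx.
have ZE w : Z w = xi + scale_mx Omega *m
    col_mx (usubmx (usubmx (X w))) (dsubmx (usubmx (X w))) by rewrite vsubmxK.
have Z2E w :
    dsubmx xi + scale_mx (drsubmx Omega) *m usubmx (X' w) = dsubmx (Z w).
  by rewrite X'E col_mxKu ZE dsubmx_affine.
(* The new latent event is the old one together with the condition on Y_1. *)
have FE : F = C `&` [set w | forall i, 0 < (s *: (usubmx (Z w) + y1)) i 0].
  apply/seteqP; split=> w; rewrite /F /C /setI /mkset X'E col_mxKd add_col_mx ZE.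
    move=> H; split=> [i|].
      by have := H (rshift _ i); rewrite col_mxEd.
    apply/orthant_standardized => // i.
    by have := H (lshift _ i); rewrite col_mxEu.
  move=> [HC /(orthant_standardized _ _ _ O0)HZ] i.
  by case: (split_ordP i) => j ->; rewrite ?col_mxEu ?col_mxEd.
pose D B := [set y : 'cV[R]_(d1 + d2) | B (dsubmx y)] `&`
  [set y | forall i, 0 < (s *: (usubmx y + y1)) i 0].
have mD B : measurable B -> measurable (D B).
  move=> mB; apply: measurableI; last exact: measurable_usubmx_orthant.
  by have := @measurable_dsubmx R d1 d2 measurableT B mB; rewrite setTI.
(* The law of Y is known on events of R^(d1 + d2) only, whence the detour
   through the cylinder D B. *)
have PD B : measurable B -> P ((fun t => dsubmx (Y t)) @^-1` B `&` E) =
    (fine (Q ((fun w => dsubmx (Z w)) @^-1` B `&` F)) / fine (Q C))%:E.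
  move=> mB; have := YE _ (mD B mB); rewrite /cond_distribution => PYD.
  rewrite (_ : P _ = distribution P Y (D B))// PYD FE.
  set DB := _ `&` C; set BF := _ `&` (C `&` _).
  rewrite (_ : DB = BF)//.
  by apply/seteqP; split=> w /= => [[[? ?] ?]|[? [? ?]]]; do ?split.
have mF : measurable F.
  exact: (measurable_funPTI X' (measurable_dsubmx_orthant (col_mx z1 tau))).
have mC : measurable C.
  exact: (measurable_funPTI X (measurable_dsubmx_orthant tau)).
(* F only constrains the last d1 + m coordinates of X'; it contains the event
   that moreover the first d2 coordinates are positive, an orthant event. *)
have QF0 : 0 < fine (Q F).
  rewrite fine_gt0// (le_lt_trans (probability_le1 Q mF)) ?ltry// andbT.
  apply: (lt_le_trans (normal_orthant_gt0 (col_mx 0 (col_mx z1 tau)) NX' rS')).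
  apply: le_measure; rewrite ?inE//.
    exact: (measurable_funPTI X' (measurable_shifted_orthant _)).
  move=> w /= Hw i; have := Hw (rshift _ i).
  by rewrite -[mulmx_RV _ _ _]vsubmxK add_col_mx col_mxEd.
have QC0 : 0 < fine (Q C).
  apply: (lt_le_trans QF0); rewrite fine_le ?fin_num_measure//.
  by apply: le_measure; rewrite ?inE// FE => w [].
have PE : P E = (fine (Q F) / fine (Q C))%:E.
  by have := PD setT measurableT; rewrite !preimage_setT !setTI.
split; first by rewrite PE lte_fin divr_gt0.
split => //.
- by move=> i; rewrite drsubmxE.
- exact: correlation_mx_star'.
exists d', S, Q, X'; split=> // B mB.
rewrite {1}/cond_distribution PE PD//= /cond_distribution; congr EFin.
under [in RHS]eq_fun do rewrite Z2E.
by rewrite -/F; field; rewrite !gt_eqF.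
Qed.

Theorem proposition4 (R : realType) (d1 d2 m : nat)
    (hd1 : (0 < d1)%N) (hd2 : (0 < d2)%N) (hm : (0 < m)%N)
    (xi : 'cV[R]_(d1 + d2)) (Omega : 'M[R]_(d1 + d2))
    (Delta : 'M[R]_(d1 + d2, m)) (tau : 'cV[R]_m) (Gamma : 'M[R]_m)
    (disp : measure_display) (T : measurableType disp) (P : probability T R)
    (Y : {RV P >-> 'cV[R]_(d1 + d2)})
    (hY : is_SUN (distribution P Y) xi Omega Delta tau Gamma)
    (y1 : 'cV[R]_d1) :
  let Y1 := fun t => usubmx (Y t) in
  let Y2 := fun t => dsubmx (Y t) in
  let xi1 := usubmx xi in
  let xi2 := dsubmx xi in
  let Omega22 := drsubmx Omega in
  let Obar11 := ulsubmx (corr_mx Omega) in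
  let Obar21 := dlsubmx (corr_mx Omega) in
  let omega1 := ulsubmx (scale_mx Omega) in
  let Delta1 := usubmx Delta in
  let Delta2 := dsubmx Delta in
  let z1_tilde := invmx omega1 *m (xi1 + y1) in
  let z1_hat := invmx omega1 *m (- xi1 - y1) in
  let E_pos := [set t | forall i, 0 < (Y1 t + y1) i 0] in
  let E_neg := [set t | forall i, (Y1 t + y1) i 0 < 0] in
  ((0 < P E_pos)%E /\
   is_SUN (cond_distribution P Y2 E_pos)
     xi2 Omega22 (row_mx Obar21 Delta2) (col_mx z1_tilde tau)
     (block_mx Obar11 Delta1 Delta1^T Gamma)) /\
  ((0 < P E_neg)%E /\
   is_SUN (cond_distribution P Y2 E_neg)
     xi2 Omega22 (row_mx (- Obar21) Delta2) (col_mx z1_hat tau)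
     (block_mx Obar11 (- Delta1) (- Delta1^T) Gamma)).
Proof.
move=> Y1 Y2 xi1 xi2 Omega22 Obar11 Obar21 omega1 Delta1 Delta2 z1_tilde z1_hat
  E_pos E_neg; split.
- have posE : [set t | forall i, 0 < (1 *: (usubmx (Y t) + y1)) i 0] = E_pos.
    by apply/seteqP; split=> t /= + i => /(_ i); rewrite scale1r.
  by have := SUN_cond_orthant y1 (mulr1 1) hY; rewrite posE /= !scale1r.
- have negE : [set t | forall i, 0 < (-1 *: (usubmx (Y t) + y1)) i 0] = E_neg.
    apply/seteqP; split=> t /= + i => /(_ i);
      by rewrite scaleN1r [X in 0 < X]mxE oppr_gt0.
  have ss : -1 * -1 = 1 :> R by rewrite mulrNN mulr1.
  have := SUN_cond_orthant y1 ss hY.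
  by rewrite negE /= !scaleN1r opprD [(- usubmx Delta)^T]linearN.
Qed.
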